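(* Let $H$ be a complex Hilbert space and let $\varphi:\mathscr{B}(H)\to\mathscr{B}(H)$ be a normal completely positive map. Let $(\pi,H_K,V)$ be the minimal Stinespring dilation of $\varphi$ in which $H_K$ is the reproducing kernel Hilbert space of the kernel $K((S,a),(T,b))=\langle a,\varphi(S^{*}T)b\rangle$ on $\mathscr{B}(H)\times H$, $Vb=K_{(I,b)}$, and $\pi(S)K_{(T,b)}=K_{(ST,b)}$. Fix an orthonormal basis $\{e_i\}_{i\in J}$ of $H$ and let $E_{ij}=|e_i\rangle\langle e_j|$. Let $H_{\hat K}$ be the reproducing kernel Hilbert space of the kernel on $J\times H$ $$\hat K\big((i,a),(j,b)\big):=\langle a,\varphi(E_{ij})b\rangle .$$ Then there is a (canonical) unitary $U:H_K\to H\otimes H_{\hat K}$ such that: 1. $U\pi(S)U^{*}=S\otimes I_{H_{\hat K}}$ for all $S\in\mathscr{B}(H)$; 2. $UV=W$, where $W:H\to H\otimes H_{\hat K}$ is the operator $$Wa:=\sum_i e_i\otimes\hat K_{(i,a)},\qquad a\in H .$$ Consequently, for all $S\in\mathscr{B}(H)$, $$\varphi(S)=W^{*}\big(S\otimes I_{H_{\hat K}}\big)W .$$ Furthermore, for any orthonormal basis $\{f_\alpha\}$ of $H_{\hat K}$, setting $$V_\alpha:=\big(I_H\otimes\langle f_\alpha,\cdot\rangle\big)W:H\to H,$$ one has, for all $S\in\mathscr{B}(H)$, the Kraus form $$\varphi(S)=\sum_\alpha V_\alpha^{*}SV_\alpha ,$$ with convergence in the strong operator topology.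
   Context: All inner products are linear in the second variable. $\mathscr{B}(H)$ is the algebra of bounded operators on $H$; a completely positive map is normal if it is ultraweakly (weak-$*$) continuous. $|e_i\rangle\langle e_j|$ is the rank-one operator $h\mapsto e_i\langle e_j,h\rangle$. For a positive definite kernel $L:X\times X\to\mathbb{C}$ (meaning $\sum\overline{c_i}c_jL(x_i,x_j)\ge0$ for all finite families), its reproducing kernel Hilbert space is the Hilbert space of functions on $X$ in which the sections $L_x:=L(\cdot,x)$ have dense linear span and $u(x)=\langle L_x,u\rangle$; in particular $\langle L_x,L_y\rangle=L(x,y)$. Both $K$ and $\hat K$ are positive definite. A dilation $(\pi,H_K,V)$, with $\varphi(S)=V^*\pi(S)V$, is minimal if the closed linear span of $\{\pi(S)Vb\}$ is $H_K$. Infinite sums over basis indices are limits over finite subsets; the series defining $Wa$ converges in norm. $I_H\otimes\langle f_\alpha,\cdot\rangle:H\otimes H_{\hat K}\to H$ is the bounded operator with $x\otimes y\mapsto\langle f_\alpha,y\rangle x$. *)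

(* Defs.v *)
From HB Require Import structures.
From mathcomp Require Import all_boot all_order all_algebra.
From mathcomp Require Import finmap complex sesquilinear ring.
From mathcomp Require Import all_classical all_reals topology normedtype sequences.
From mathcomp.analysis.showcase Require Export summability.

Set Implicit Arguments.
Unset Strict Implicit.
Unset Printing Implicit Defensive.

Import Order.TTheory GRing.Theory Num.Theory.
Import numFieldNormedType.Exports.

Local Open Scope classical_set_scope.
Local Open Scope ring_scope.
Local Open Scope complex_scope.

(* Complex Hilbert spaces; the inner product is linear in the second variable.
   The norm of a normed module over R[i] takes its values in R[i], where
   [0 <= z] means that z is real and nonnegative. *)
HB.mixin Record CompleteNormedModule_isHilbert (R : realType) H
    of CompleteNormedModule R[i] H := {
  inner : H -> H -> R[i] ;
  innerDr : forall x y z, inner x (y + z) = inner x y + inner x z ;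
  innerZr : forall x (c : R[i]) y, inner x (c *: y) = c * inner x y ;
  inner_conj : forall x y, inner y x = Num.conj (inner x y) ;
  inner_norm : forall x, inner x x = `|x| ^+ 2
}.

#[short(type="hilbertType")]
HB.structure Definition Hilbert (R : realType) :=
  {H of CompleteNormedModule R[i] H & CompleteNormedModule_isHilbert R H}.

Section InnerProduct.
Context {R : realType} {H : hilbertType R}.
Implicit Types (x y z : H) (c : R[i]).

Lemma innerDl x y z : inner (x + y) z = inner x z + inner y z.
Proof. by rewrite inner_conj innerDr rmorphD/= -!inner_conj. Qed.

Lemma innerZl c x y : inner (c *: x) y = Num.conj c * inner x y.
Proof. by rewrite inner_conj innerZr rmorphM/= -inner_conj. Qed.

Lemma cauchy_schwarz x y : `|inner x y| <= `|x| * `|y|.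
Proof.
have [->|x0] := eqVneq x 0.
  have -> : inner 0 y = 0 :> R[i].
    by rewrite -(scale0r (0 : H)) innerZl conjC0 mul0r.
  by rewrite normr0 mulr_ge0.
have nx : 0 < `|x| by rewrite normr_gt0.
rewrite -(@ler_pXn2r _ 2)// ?nnegrE ?mulr_ge0// exprMn.
set a := inner x y; set s := `|x| ^+ 2.
have s0 : 0 < s by rewrite exprn_gt0.
have sr : Num.conj s = s by rewrite conj_Creal// ger0_real// ltW.
have xx : inner x x = s by rewrite inner_norm.
have := exprn_ge0 2 (normr_ge0 (s *: y - a *: x)).
rewrite -inner_norm -scaleNr !(innerDl, innerDr, innerZl, innerZr) -/a.
rewrite (inner_conj x y) -/a xx rmorphN/= sr inner_norm => h.
suff : 0 <= s * (s * `|y| ^+ 2 - `|a| ^+ 2).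
  by rewrite pmulr_rge0// subr_ge0.
rewrite normCK; move: h; congr (_ <= _).
set b := Num.conj a; ring.
Qed.

Definition lspan (A : set H) : set H :=
  [set u | exists (n : nat) (c : 'I_n -> R[i]) (v : 'I_n -> H),
     (forall i, A (v i)) /\ u = \sum_(i < n) c i *: v i].

Definition dense_span (A : set H) : Prop := closure (lspan A) = setT.

Definition orthonormal_basis (J : choiceType) (e : J -> H) : Prop :=
  (forall i j, inner (e i) (e j) = (i == j)%:R) /\ dense_span (range e).

End InnerProduct.

Definition bounded_linear {R : realType} {H1 H2 : hilbertType R} :
    {pred H1 -> H2} :=
  [pred f : H1 -> H2 | `[< linear f /\
     exists M : R[i], forall x, `|f x| <= M * `|x| >] ].

(* The space of bounded operators, as a subtype of the module of functions. *)
Record bop {R : realType} (H1 H2 : hilbertType R) := Bop {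
  bop_fun :> H1 -> H2 ;
  bop_prop : bop_fun \in bounded_linear
}.

Notation "''B' ( H1 , H2 )" := (bop H1 H2)
  (at level 8, format "''B' ( H1 ,  H2 )") : type_scope.
Notation "''B' ( H )" := (bop H H)
  (at level 8, format "''B' ( H )") : type_scope.

Section BopModule.
Context {R : realType} (H1 H2 : hilbertType R).

Lemma bounded_linear_submod_closed :
  submod_closed (@bounded_linear R H1 H2).
Proof.
split=> [|a f g].
  apply/asboolP; split=> [k u v|]; first by rewrite /= scaler0 addr0.
  by exists 0 => x; rewrite mul0r normr0.
move=> /asboolP[lf [M fM]] /asboolP[lg [N gN]]; apply/asboolP; split.
  move=> k u v /=; rewrite !fctE lf lg !scalerDr !scalerA [a * k]mulrC.
  by rewrite addrACA.
exists (`|a| * M + N) => x; rewrite !fctE (le_trans (ler_normD _ _))// mulrDl.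
by rewrite lerD// normrZ -mulrA ler_wpM2l.
Qed.

HB.instance Definition _ := GRing.isSubmodClosed.Build R[i] (H1 -> H2)
  (@bounded_linear R H1 H2) bounded_linear_submod_closed.
HB.instance Definition _ := [isSub for @bop_fun R H1 H2].
HB.instance Definition _ := [Choice of 'B(H1, H2) by <:].
HB.instance Definition _ :=
  [SubChoice_isSubLmodule of 'B(H1, H2) by <:].

Lemma bop_linear (T : 'B(H1, H2)) : linear T.
Proof. by have /asboolP[] := bop_prop T. Qed.

HB.instance Definition _ (T : 'B(H1, H2)) :=
  GRing.isLinear.Build R[i] H1 H2 *:%R (bop_fun T) (@bop_linear T).

Lemma bop_bounded (T : 'B(H1, H2)) :
  exists2 M : R[i], 0 <= M & forall x, `|T x| <= M * `|x|.
Proof.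
have /asboolP[_ [M TM]] := bop_prop T; exists `|M| => // x.
have h := le_trans (normr_ge0 _) (TM x).
by rewrite (le_trans (TM x))// -{1}(ger0_norm h) normrM normr_id.
Qed.

End BopModule.

Section BopAlgebra.
Context {R : realType} {H1 H2 H3 : hilbertType R}.

Fact bcomp_subproof (S : 'B(H2, H3)) (T : 'B(H1, H2)) :
  (S \o T : H1 -> H3) \in bounded_linear.
Proof.
apply/asboolP; split=> [k u v|]; first by rewrite /= !linearP.
have [M M0 SM] := bop_bounded S; have [N _ TN] := bop_bounded T.
exists (M * N) => x /=.
by rewrite (le_trans (SM _))// -mulrA ler_wpM2l.
Qed.

Definition bcomp S T : 'B(H1, H3) := Bop (bcomp_subproof S T).

Fact bid_subproof : (idfun : H1 -> H1) \in bounded_linear.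
Proof. by apply/asboolP; split=> //; exists 1 => x; rewrite mul1r. Qed.

Definition bid : 'B(H1) := Bop bid_subproof.

(* The adjoint; it exists by the Riesz representation theorem. *)
Definition adj (T : 'B(H1, H2)) : 'B(H2, H1) :=
  xget 0 [set S : 'B(H2, H1) | forall x y, inner (S x) y = inner x (T y)].

Fact ketbra_subproof (x : H2) (y : H1) :
  (fun h => inner y h *: x) \in bounded_linear.
Proof.
apply/asboolP; split=> [k u v|].
  by rewrite innerDr innerZr scalerDl scalerA.
exists (`|y| * `|x|) => h; rewrite normrZ mulrAC ler_wpM2r//.
exact: cauchy_schwarz.
Qed.

(* |x><y| *)
Definition ketbra x y : 'B(H1, H2) := Bop (ketbra_subproof x y).

End BopAlgebra.

Arguments bid {R} H1.

Notation "S ∘ T" := (bcomp S T)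
  (at level 40, left associativity, format "S  ∘  T") : bop_scope.
Notation "T ^†" := (adj T) (at level 2, format "T ^†")
  : bop_scope.
Local Open Scope bop_scope.

Definition unitary_op {R : realType} {H1 H2 : hilbertType R} (U : 'B(H1, H2)) :
    Prop :=
  U^† ∘ U = bid H1 /\ U ∘ U^† = bid H2.

Section CompletelyPositive.
Context {R : realType} {H : hilbertType R}.

(* Positivity of the operator matrix A, acting on the direct sum of n copies
   of H. *)
Definition opmx_ge0 n (A : 'I_n -> 'I_n -> 'B(H)) : Prop :=
  forall x : 'I_n -> H,
    0 <= \sum_(i < n) \sum_(j < n) inner (x i) (A i j (x j)).

Definition completely_positive (phi : 'B(H) -> 'B(H)) : Prop :=
  forall n (A : 'I_n -> 'I_n -> 'B(H)),
    opmx_ge0 A -> opmx_ge0 (fun i j => phi (A i j)).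

Definition sq_summable (x : nat -> H) : Prop :=
  cvgn (series (fun n => `|x n| ^+ 2 : R[i]^o)).

Definition sq_summable_pair : Type :=
  {p : (nat -> H) * (nat -> H) | sq_summable p.1 /\ sq_summable p.2}.

Definition ultraweak_functional (T : 'B(H)) (p : sq_summable_pair) : R[i]^o :=
  limn (series (fun n => inner ((sval p).1 n) (T ((sval p).2 n)) : R[i]^o)).

(* The initial topology for the functionals T |-> \sum_n <x_n, T y_n>, where
   \sum_n |x_n|^2 and \sum_n |y_n|^2 converge. *)
Definition ultraweak : Type :=
  initial_topology
    (ultraweak_functional : 'B(H) -> {ptws sq_summable_pair -> R[i]^o}).

HB.instance Definition _ := Topological.on ultraweak.

End CompletelyPositive.

Arguments ultraweak {R} H.

Definition normal_map {R : realType} {H : hilbertType R} (phi : 'B(H) -> 'B(H)) :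
    Prop :=
  continuous (phi : ultraweak H -> ultraweak H).

(* The reproducing kernel Hilbert space of L. The injective linear map
   [rkhs_ev] presents its elements as functions on X, and [rkhs_sec y] is the
   element whose function is the section L(-, y). *)
Record rkhs {R : realType} {X : Type} (L : X -> X -> R[i]) := Rkhs {
  rkhs_sort :> hilbertType R ;
  rkhs_ev : rkhs_sort -> X -> R[i] ;
  rkhs_sec : X -> rkhs_sort ;
  rkhs_ev_linear : forall (c : R[i]) u v x,
    rkhs_ev (c *: u + v) x = c * rkhs_ev u x + rkhs_ev v x ;
  rkhs_ev_inj : injective rkhs_ev ;
  rkhs_ev_sec : forall x y, rkhs_ev (rkhs_sec y) x = L x y ;
  rkhs_dense : dense_span (range rkhs_sec) ;
  rkhs_ev_reproducing : forall u x, rkhs_ev u x = inner (rkhs_sec x) u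
}.

(* A Hilbert space tensor product of H1 and H2; these conditions determine it
   up to a unique unitary commuting with [tens]. *)
Record htensor {R : realType} (H1 H2 : hilbertType R) := Htensor {
  htensor_sort :> hilbertType R ;
  tens : {bilinear H1 -> H2 -> htensor_sort} ;
  inner_tens : forall x y x' y',
    inner (tens x y) (tens x' y') = inner x x' * inner y y' ;
  tens_dense : dense_span [set tens p.1 p.2 | p in [set: H1 * H2]]
}.

Section Tensor.
Context {R : realType} {H1 H2 : hilbertType R} (HT : htensor H1 H2).

(* S \otimes I, the bounded operator with x \otimes y |-> S x \otimes y. *)
Definition tensI (S : 'B(H1)) : 'B(HT) :=
  xget 0 [set A : 'B(HT) | forall x y, A (tens HT x y) = tens HT (S x) y].

(* I \otimes <f, ->, the bounded operator with x \otimes y |-> <f, y> x. *)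
Definition slice (f : H2) : 'B(HT, H1) :=
  xget 0 [set A : 'B(HT, H1) | forall x y, A (tens HT x y) = inner f y *: x].

End Tensor.

Section Stinespring.
Context {R : realType} {H G : hilbertType R}.

Record stinespring_dilation (phi : 'B(H) -> 'B(H))
    (pi : {linear 'B(H) -> 'B(G)}) (V : 'B(H, G)) : Prop := {
  repr_comp : forall S T, pi (S ∘ T) = pi S ∘ pi T ;
  repr_id : pi (bid H) = bid G ;
  repr_adj : forall S, pi S^† = (pi S)^† ;
  dilationE : forall S, phi S = V^† ∘ pi S ∘ V
}.

Definition minimal_dilation (pi : 'B(H) -> 'B(G)) (V : 'B(H, G)) : Prop :=
  dense_span [set pi p.1 (V p.2) | p in [set: 'B(H) * H]].

End Stinespring.

Section Kernels.
Context {R : realType} {H : hilbertType R} (phi : 'B(H) -> 'B(H)).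

Definition cp_kernel (p q : 'B(H) * H) : R[i] :=
  inner p.2 (phi (p.1^† ∘ q.1) q.2).

Definition unit_kernel (J : choiceType) (e : J -> H) (p q : J * H) : R[i] :=
  inner p.2 (phi (ketbra (e p.1) (e q.1)) q.2).

End Kernels.

(* Main.v *)
(* The rank-one sections K_(|x><e_i|, b) have Gram matrix
   <x, y> <a, phi(E_ij) b>, the same as the vectors x (x) Khat_(i, b), so
   K_(|x><e_i|, b) |-> x (x) Khat_(i, b) extends to a unitary U once the
   rank-one sections are known to span H_K. For this, let P be the projection
   onto finitely many of the e_i and Q = 1 - P: then K_(T P, b) is a finite sum
   of rank-one sections, and |K_(T, b) - K_(T P, b)|^2 = <b, phi(Q T^* T Q) b>
   tends to 0 by normality, since Q T^* T Q tends to 0 ultraweakly. Taking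
   T = 1 identifies U V with W. The Kraus form holds because I (x) <f, -> is the
   adjoint of x |-> x (x) f, so that V_f^* S V_f is W^* (S (x) I) p_f W with p_f
   the projection onto H (x) f, and these projections sum strongly to 1. *)
Require Import Defs.
From HB Require Import structures.
From mathcomp Require Import all_boot all_order all_algebra.
From mathcomp Require Import finmap complex sesquilinear ring.
From mathcomp Require Import all_classical all_reals topology normedtype sequences.
From mathcomp.analysis.showcase Require Import summability.

Set Implicit Arguments.
Unset Strict Implicit.
Unset Printing Implicit Defensive.

Import Order.TTheory GRing.Theory Num.Theory.
Import numFieldNormedType.Exports.

Local Open Scope classical_set_scope.
Local Open Scope ring_scope.
Local Open Scope bop_scope.

#[local] Existing Instance totally_filter.

(** * Inner product identities, dense spans, completeness and Riesz representation *)

Section HilbertBasics.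
Context {R : realType} {H : hilbertType R}.
Implicit Types (x y z : H) (c : R[i]) (A : set H).

Lemma inner0r x : inner x 0 = 0.
Proof. by rewrite -(scale0r 0) innerZr mul0r. Qed.

Lemma inner0l x : inner 0 x = 0.
Proof. by rewrite inner_conj inner0r conjC0. Qed.

Lemma innerBr x y z : inner x (y - z) = inner x y - inner x z.
Proof. by rewrite innerDr -scaleN1r innerZr mulN1r. Qed.

Lemma innerBl x y z : inner (x - y) z = inner x z - inner y z.
Proof. by rewrite inner_conj innerBr rmorphB/= -!inner_conj. Qed.

Lemma inner_sumr (I : Type) (r : seq I) (P : pred I) (F : I -> H) x :
  inner x (\sum_(i <- r | P i) F i) = \sum_(i <- r | P i) inner x (F i).
Proof.
by elim/big_rec2: _ => [|i u v _ <-]; rewrite ?inner0r ?innerDr.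
Qed.

Lemma inner_suml (I : Type) (r : seq I) (P : pred I) (F : I -> H) x :
  inner (\sum_(i <- r | P i) F i) x = \sum_(i <- r | P i) inner (F i) x.
Proof.
by elim/big_rec2: _ => [|i u v _ <-]; rewrite ?inner0l ?innerDl.
Qed.

Lemma inner_eq x y : (forall z, inner z x = inner z y) -> x = y.
Proof.
move=> xy; apply/eqP; rewrite -subr_eq0 -normr_eq0 -sqrf_eq0 -inner_norm.
by rewrite innerBr xy subrr.
Qed.

(** One factor [|x|] cancels from [<x, x> = |x|^2]; estimates obtained by pairing a vector with
    itself become norm bounds. *)
Lemma norm_inner_le x (M : R[i]) :
  0 <= M -> `|inner x x| <= M * `|x| -> `|x| <= M.
Proof.
move=> M0; rewrite inner_norm normrX normr_id expr2.
have [->|x0] := eqVneq x 0; first by rewrite normr0.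
by rewrite ler_pM2r// normr_gt0.
Qed.

Lemma closureP A x :
  closure A x <-> forall d : R[i], 0 < d -> exists2 y, A y & `|x - y| <= d.
Proof.
split=> [Ax d d0|Ax B].
  have [|y [Ay yx]] := Ax (ball x d); first exact: nbhsx_ballx.
  by exists y => //; move: yx; rewrite -ball_normE => /ltW.
rewrite -nbhs_ballE => -[d d0 dB].
have [y Ay yx] := Ax _ (divr_gt0 d0 (ltr0Sn _ 1)).
exists y; split=> //; apply: dB; rewrite -ball_normE /ball_/=.
by rewrite (le_lt_trans yx)// ltr_pdivrMr// ltr_pMr// ltr1n.
Qed.

(** Finite combinations are reached by linear stability, all other vectors by approximation.
    Operator identities and strong convergence are checked on generators this way. *)
Lemma dense_span_ind A (P : set H) :
    dense_span A -> A `<=` P -> P 0 ->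
    (forall c u v, P u -> P v -> P (c *: u + v)) ->
    (forall u, (forall d : R[i], 0 < d -> exists2 v, P v & `|u - v| <= d) -> P u) ->
  forall u, P u.
Proof.
move=> dA AP P0 PD Pcl u; apply: Pcl.
have : closure (lspan A) u by rewrite dA.
move=> /closureP uA d /uA[v [n [c [w [Aw ->]]]] vd].
exists (\sum_(i < n) c i *: w i) => //.
elim/big_rec: _ => [|i x _ Px]; first exact: P0.
by apply: PD => //; apply: AP.
Qed.

Lemma lspanP A c u v : lspan A u -> lspan A v -> lspan A (c *: u + v).
Proof.
move=> [n [a [x [Ax ->]]]] [m [b [y [Ay ->]]]].
exists (n + m)%N, (fun i : 'I_(n + m) =>
  match fintype.split i with inl j => c * a j | inr j => b j end).
exists (fun i : 'I_(n + m) =>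
  match fintype.split i with inl j => x j | inr j => y j end).
split=> [i|]; first by case: fintype.split.
rewrite big_split_ord/= scaler_sumr; congr (_ + _); apply: eq_bigr => i _.
  by rewrite (unsplitK (inl _ i)) scalerA.
by rewrite (unsplitK (inr _ i)).
Qed.

Lemma mem_lspan A : A `<=` lspan A.
Proof.
move=> x Ax; exists 1%N, (fun=> 1), (fun=> x).
by rewrite big_ord1 scale1r; split.
Qed.

Lemma lspan0 A : lspan A 0.
Proof.
exists 0%N, (fun=> 0), (fun=> 0); split; first by case.
by rewrite big_ord0.
Qed.

Lemma dense_span_trans A B :
  dense_span A -> A `<=` closure (lspan B) -> dense_span B.
Proof.
move=> dA AB; rewrite /dense_span -subTset => u _.
apply: (dense_span_ind dA AB) => [|c v w /closureP Pv /closureP Pw|{}u Pu].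
- by apply: subset_closure; exact: lspan0.
- apply/closureP => d d0.
  (* Adding 1 keeps the divisor positive when [c = 0]. *)
  have c1 : 0 < `|c| + 1 by rewrite ltr_wpDl.
  have [v' Bv vv'] := Pv _ (divr_gt0 (divr_gt0 d0 (ltr0Sn _ 1)) c1).
  have [w' Bw ww'] := Pw _ (divr_gt0 d0 (ltr0Sn _ 1)).
  exists (c *: v' + w'); first exact: lspanP.
  rewrite opprD addrACA -scalerBr (le_trans (ler_normD _ _))// normrZ.
  rewrite (splitr d) lerD//; rewrite ler_pdivlMr// mulrC in vv'.
  by rewrite (le_trans _ vv')// ler_wpM2r// lerDl.
- apply/closureP => d d0.
  have [v /closureP Pv uv] := Pu _ (divr_gt0 d0 (ltr0Sn _ 1)).
  have [w Bw vw] := Pv _ (divr_gt0 d0 (ltr0Sn _ 1)).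
  exists w => //; rewrite -(subrKA v) (splitr d).
  by rewrite (le_trans (ler_normD _ _))// lerD.
Qed.

(* [R[i]] is only partially ordered: [Num.min] is of no use here. *)
Lemma exists_min_gt0 (d d' : R[i]) : 0 < d -> 0 < d' ->
  exists2 m, 0 < m & m <= d /\ m <= d'.
Proof.
move=> d0 d'0.
have : d >=< d' by apply: real_comparable; rewrite gtr0_real.
by case/orP => dd'; [exists d|exists d'].
Qed.

(** The sets [A d], of approximations with precision [d], replace a Cauchy sequence. This serves
    both for the Riesz vector and for extending isometries. *)
Lemma complete_approx (A : R[i] -> set H) :
    (forall d, 0 < d -> A d !=set0) ->
    (forall d d' x y, 0 < d -> 0 < d' -> A d x -> A d' y -> `|x - y| <= d + d') ->
  exists x, forall d, 0 < d -> exists2 y, A d y & `|x - y| <= d.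
Proof.
move=> A0 AA.
(* The union over [d' <= d] makes the family monotone, hence a filter base. *)
pose B (d : R[i]) := [set x | exists2 d', 0 < d' <= d & A d' x].
have FF : ProperFilter (filter_from [set d : R[i] | 0 < d] B).
  apply: filter_from_proper; last first.
    by move=> d d0; have [x Ax] := A0 d d0; exists x, d => //; rewrite d0/=.
  apply: filter_from_filter; first by exists 1 => /=.
  move=> d d' d0 d'0; have [m m0 [md md']] := exists_min_gt0 d0 d'0.
  exists m => // x [e /andP[e0 em] Ax].
  by split; exists e => //; rewrite e0/= (le_trans em).
have /cauchy_cvgP/cvg_ex[/= x Fx] : cauchy (filter_from [set d : R[i] | 0 < d] B).
  apply: cauchy_exP => d /= d0; have d4 : 0 < d / 4 by rewrite divr_gt0.
  have [x Ax] := A0 _ d4; exists x, (d / 4) => // y [d' /andP[d'0 d'd] Ay].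
  rewrite -ball_normE /ball_/= (le_lt_trans (AA _ _ _ _ d4 d'0 Ax Ay))//.
  rewrite (le_lt_trans (lerD (lexx _) d'd))//.
  have -> : d / 4 + d / 4 = d / 2 by field.
  by rewrite ltr_pdivrMr// ltr_pMr// ltr1n.
exists x => d d0; have d2 : 0 < d / 2 by rewrite divr_gt0.
(* Any [y] in [A d] works: a point [z] of precision at most [e / 2] lying within [e / 2] of [x]
   gives [|x - y| <= d + e]. *)
have [y Ay] := A0 _ d0; exists y => //.
apply/ler_addgt0Pl => e e0.
pose e2 := e / 2; have e20 : 0 < e2 by rewrite divr_gt0.
have [] := Fx (ball x e2); first exact: nbhsx_ballx.
move=> d' /= d'0 d'B; have [m m0 [md' me]] := exists_min_gt0 d'0 e20.
have [z Az] := A0 _ m0.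
have : ball x e2 z by apply: d'B; exists m; rewrite ?m0.
rewrite -ball_normE /ball_/= => /ltW xz.
rewrite -(subrKA z) (le_trans (ler_normD _ _))// (splitr e) -addrA lerD//.
by rewrite (le_trans (AA _ _ _ _ m0 d0 Az Ay))// lerD.
Qed.

(** Vectors representing [g] up to [d |y|] and [d' |y|] are at distance at most [d + d']: take [y]
    to be their difference. Hence they converge. *)
Lemma riesz_approx (g : H -> R[i]) :
    (forall d : R[i], 0 < d ->
      exists x, forall y, `|inner x y - g y| <= d * `|y|) ->
  exists x, forall y, inner x y = g y.
Proof.
move=> gd.
pose A (d : R[i]) := [set x | forall y, `|inner x y - g y| <= d * `|y|].
have [|x xA] := @complete_approx A gd.
  move=> d d' x y d0 d'0 Ax Ay; apply: norm_inner_le.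
    by rewrite addr_ge0// ltW.
  rewrite innerBl -(subrKA (g (x - y))) (le_trans (ler_normD _ _))// mulrDl.
  by rewrite lerD// distrC.
exists x => y; apply/eqP; rewrite -subr_eq0 -normr_le0.
apply/ler_addgt0Pl => d d0; rewrite addr0.
have y1 : 0 < `|y| + 1 by rewrite ltr_wpDl.
pose e := d / 2 / (`|y| + 1).
have e0 : 0 < e by rewrite !divr_gt0.
have [x' Ax' xx'] := xA _ e0.
rewrite -(subrKA (inner x' y)) (le_trans (ler_normD _ _))// (splitr d).
have ed : e * `|y| <= d / 2.
  rewrite /e mulrAC ler_pdivrMr// ler_pM2l ?divr_gt0// lerDl//.
rewrite lerD// ?(le_trans (Ax' _))// -innerBl.
by rewrite (le_trans (cauchy_schwarz _ _))// (le_trans _ ed)// ler_wpM2r.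
Qed.

(* The Riesz vector minimizes [x |-> |x|^2 - 2 Re (g x)]. *)
Lemma riesz_representation (g : H -> R[i]) (M : R[i]) :
    (forall c u v, g (c *: u + v) = c * g u + g v) ->
    (forall u, `|g u| <= M * `|u|) ->
  exists x, forall y, inner x y = g y.
Proof.
move=> gl gM; apply: riesz_approx => d d0.
pose F u : R[i] := inner u u - g u - (g u)^*.
have FR u : F u \is Num.real.
  rewrite CrealE /F !rmorphB/= conjCK -inner_conj -!addrA.
  by rewrite [- (g u)^* - _]addrC.
(* [F] takes real values inside the partially ordered [R[i]]; its infimum is formed in [R]. *)
pose J u : R := complex.Re (F u).
have JE u : (J u)%:C%C = F u by rewrite RRe_real.
pose E := range J.
have M0 (u : H) : 0 <= M * `|u| by exact: le_trans (normr_ge0 _) (gM u).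
have Elb : has_lbound E.
  (* The bound is [|u|^2 - 2 |M| |u| + |M|^2 = (|u| - |M|)^2 >= 0]. *)
  exists (- complex.Re (`|M| ^+ 2)) => _ [u _ <-].
  have -> : - complex.Re (`|M| ^+ 2) = complex.Re (- `|M| ^+ 2).
    by rewrite raddfN.
  rewrite -lecR JE RRe_real ?rpredN ?rpredX ?normr_real// /F.
  rewrite inner_norm.
  have gR : g u + (g u)^* \is Num.real.
    by rewrite CrealE rmorphD/= conjCK addrC.
  rewrite -addrA -opprD lerBrDl lerBlDr (le_trans (real_ler_norm gR))//.
  rewrite (le_trans (ler_normD _ _))// norm_conjC.
  have MM : `|g u| <= `|M| * `|u|.
    by rewrite (le_trans (gM u))// -{1}(ger0_norm (M0 u)) normrM normr_id.
  rewrite (le_trans (lerD MM MM))// -subr_ge0.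
  have := real_exprn_even_ge0 (n := 2) (x := `|u| - `|M|).
  rewrite rpredB ?normr_real// => /(_ isT isT).
  by rewrite sqrrB mulrC mulr2n addrAC.
have Einf : has_inf E by split => //; exists (J 0), 0.
have dR : d = (complex.Re d)%:C%C by rewrite RRe_real ?gtr0_real.
have d2 : 0 < complex.Re (d ^+ 2).
  by rewrite -ltcR RRe_real ?rpredX ?gtr0_real ?exprn_gt0.
(* The slack is [d ^+ 2] because the final estimate is [|l|^2 <= d^2 |k|^2]. *)
have [_ [x _ <-] Jx] := inf_adherent d2 Einf.
exists x => k; set l := inner x k - g k.
have [k0|k0] := eqVneq k 0.
  by rewrite /l k0 inner0r sub0r normrN (le_trans (gM 0))// normr0 !mulr0.
(* This is [F x <= F (x + h) + d ^+ 2], expanded. *)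
have Jmin h : 0 <= d ^+ 2 + (inner h h + (inner x h - g h) + (inner x h - g h)^*).
  have : J x <= J (x + h) + complex.Re (d ^+ 2).
    rewrite (le_trans (ltW Jx))// lerD2r; apply: ge_inf; first by case: Einf.
    by exists (x + h).
  have -> : J (x + h) + complex.Re (d ^+ 2) =
      complex.Re ((J (x + h))%:C%C + d ^+ 2) by rewrite raddfD.
  rewrite -lecR !JE RRe_real; last by rewrite rpredD ?FR ?rpredX ?gtr0_real.
  rewrite -subr_ge0 /F.
  rewrite -[in g (x + h)](scale1r x) gl mul1r.
  rewrite !(innerDl, innerDr) !rmorphD/= !rmorphN/= (inner_conj x h).
  congr (_ <= _); ring.
have nk : 0 < `|k| ^+ 2 by rewrite exprn_gt0// normr_gt0.
have g0 : g 0 = 0.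
  by apply/eqP; rewrite -normr_le0 (le_trans (gM 0))// normr0 mulr0.
(* The minimizer of [|c|^2 |k|^2 + 2 Re (c l)], with minimum [- |l|^2 / |k|^2]. *)
pose c := - l^* / `|k| ^+ 2.
have gZ : g (c *: k) = c * g k by rewrite -[c *: k]addr0 gl g0 addr0.
have cl : c * l = - (`|l| ^+ 2 / `|k| ^+ 2) by rewrite /c normCK; ring.
have cE : c^* = - l / `|k| ^+ 2.
  by rewrite /c rmorphM/= rmorphN/= conjCK conj_Creal// rpredV rpredX ?normr_real.
have := Jmin (c *: k).
rewrite innerZl !innerZr gZ inner_norm -mulrBr -/l cl rmorphN/=.
rewrite (@conj_Creal _ (`|l| ^+ 2 / _)) ?rpred_div ?rpredX ?normr_real// cE /c.
have -> : d ^+ 2 + (- l / `|k| ^+ 2 * (- l^* / `|k| ^+ 2 * `|k| ^+ 2)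
   - `|l| ^+ 2 / `|k| ^+ 2 - `|l| ^+ 2 / `|k| ^+ 2) =
   d ^+ 2 - `|l| ^+ 2 / `|k| ^+ 2.
  by rewrite normCK; field; rewrite normr_eq0.
rewrite subr_ge0 ler_pdivrMr// -exprMn ler_pXn2r// ?nnegrE// mulr_ge0//.
exact: ltW.
Qed.

End HilbertBasics.

(** * Bounded operators, adjoints and rank-one operators *)

Section Operators.
Context {R : realType}.
Implicit Types H : hilbertType R.

Lemma bop_eq H1 H2 (S T : 'B(H1, H2)) : S =1 T -> S = T.
Proof. by move=> ST; apply: val_inj; apply/funext. Qed.

Lemma bopD H1 H2 (S T : 'B(H1, H2)) x : (S + T) x = S x + T x.
Proof. by []. Qed.

Lemma bopB H1 H2 (S T : 'B(H1, H2)) x : (S - T) x = S x - T x.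
Proof. by []. Qed.

Lemma bopZ H1 H2 c (S : 'B(H1, H2)) x : (c *: S) x = c *: S x.
Proof. by []. Qed.

Lemma bop0 H1 H2 x : (0 : 'B(H1, H2)) x = 0.
Proof. by []. Qed.

Lemma bop_sum H1 H2 (I : Type) (r : seq I) (P : pred I) (F : I -> 'B(H1, H2)) x :
  (\sum_(i <- r | P i) F i) x = \sum_(i <- r | P i) F i x.
Proof.
by elim/big_rec2: _ => [|i u v _ <-]; rewrite ?bop0 ?bopD.
Qed.

Lemma le0_approx (a M : R[i]) : (forall d, 0 < d -> a <= M * d) -> 0 <= M -> a <= 0.
Proof.
move=> aM M0; apply/ler_addgt0Pl => d d0; rewrite addr0.
have M1 : 0 < M + 1 by rewrite ltr_wpDl.
rewrite (le_trans (aM _ (divr_gt0 d0 M1)))// mulrA ler_pdivrMr// mulrC.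
by rewrite ler_pM2l// lerDl.
Qed.

(** The operator [S - T] is bounded and vanishes on the span, hence also on its limits. *)
Lemma bop_dense_eq H1 H2 (S T : 'B(H1, H2)) A :
  dense_span A -> (forall x, A x -> S x = T x) -> S = T.
Proof.
move=> dA ST; apply: bop_eq; apply: (dense_span_ind dA ST).
- by rewrite !linear0.
- by move=> c u v Su Sv; rewrite !linearP/= Su Sv.
move=> u ud; apply/eqP; rewrite -subr_eq0 -normr_le0 -bopB.
have [M M0 STM] := bop_bounded (S - T).
apply: (le0_approx _ M0) => d /ud[v STv uv].
have -> : (S - T) u = (S - T) (u - v).
  by rewrite !bopB (linearB S) (linearB T)/= STv opprB addrA subrK.
by rewrite (le_trans (STM _))// ler_wpM2l.
Qed.

Lemma inner_dense_eq H A (x y : H) :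
  dense_span A -> (forall a, A a -> inner a x = inner a y) -> x = y.
Proof.
move=> dA Axy; apply: inner_eq; apply: (dense_span_ind dA Axy).
- by rewrite !inner0l.
- by move=> c u v xu xv; rewrite !innerDl !innerZl xu xv.
move=> u ud; apply/eqP; rewrite -subr_eq0 -innerBr -normr_le0.
apply: (@le0_approx _ `|x - y|) => // d /ud[v xyv uv].
have -> : inner u (x - y) = inner (u - v) (x - y).
  by rewrite innerBl !innerBr xyv subrr subr0.
by rewrite (le_trans (cauchy_schwarz _ _))// mulrC ler_wpM2l.
Qed.

(** Riesz applied to [y |-> <x, T y>] gives [S x]; uniqueness of the representing vector makes [S]
    linear. *)
Lemma adj_exists H1 H2 (T : 'B(H1, H2)) :
  exists S : 'B(H2, H1), forall x y, inner (S x) y = inner x (T y).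
Proof.
have [M M0 TM] := bop_bounded T.
have TR x : exists z, forall y, inner z y = inner x (T y).
  apply: (@riesz_representation _ _ _ (`|x| * M)) => [c u v|u].
    by rewrite linearP innerDr innerZr.
  by rewrite (le_trans (cauchy_schwarz _ _))// -mulrA ler_wpM2l.
have [S ST] := choice TR.
suff Sb : S \in bounded_linear by exists (Bop Sb).
apply/asboolP; split=> [c u v|].
  apply: inner_eq => z; rewrite innerDr innerZr !(inner_conj _ z) !ST.
  by rewrite innerDl innerZl rmorphD rmorphM/= conjCK.
(* The constant of [T] serves again: [|S x|^2 = <x, T (S x)> <= |x| M |S x|]. *)
exists M => x; apply: norm_inner_le; first by rewrite mulr_ge0.
by rewrite ST (le_trans (cauchy_schwarz _ _))// [M * _]mulrC -mulrA ler_wpM2l.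
Qed.

Lemma adjP H1 H2 (T : 'B(H1, H2)) x y : inner (T^† x) y = inner x (T y).
Proof.
have [S ST] := adj_exists T; rewrite /adj.
by have := @xgetPex _ 0
  [set S : 'B(H2, H1) | forall x y, inner (S x) y = inner x (T y)]
  (ex_intro _ S ST); exact.
Qed.

Lemma adjPr H1 H2 (T : 'B(H1, H2)) x y : inner x (T^† y) = inner (T x) y.
Proof. by rewrite inner_conj adjP -inner_conj. Qed.

Lemma adj_eq H1 H2 (T : 'B(H1, H2)) (S : 'B(H2, H1)) :
  (forall x y, inner (S x) y = inner x (T y)) -> T^† = S.
Proof.
move=> ST; apply: bop_eq => x; apply: inner_eq => z.
by rewrite adjPr (inner_conj (S x)) ST -inner_conj.
Qed.

Lemma adjK H1 H2 (T : 'B(H1, H2)) : T^†^† = T.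
Proof. by apply: adj_eq => x y; rewrite adjPr. Qed.

Lemma adj_comp H1 H2 H3 (S : 'B(H2, H3)) (T : 'B(H1, H2)) :
  (S ∘ T)^† = T^† ∘ S^†.
Proof. by apply: adj_eq => x y /=; rewrite !adjP. Qed.

Lemma adj_ketbra H1 H2 (x : H2) (y : H1) : (ketbra x y)^† = ketbra y x.
Proof.
by apply: adj_eq => u v /=; rewrite innerZl innerZr -inner_conj mulrC.
Qed.

Lemma ketbra_comp H1 H2 H3 (x : H3) (y z : H2) (w : H1) :
  ketbra x y ∘ ketbra z w = inner y z *: ketbra x w.
Proof. by apply: bop_eq => h; rewrite bopZ /= innerZr scalerA mulrC. Qed.

Lemma comp_ketbra H1 H2 H3 (S : 'B(H2, H3)) (x : H2) (y : H1) :
  S ∘ ketbra x y = ketbra (S x) y.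
Proof. by apply: bop_eq => h; rewrite /= linearZ. Qed.

Lemma bop_cvg H1 H2 (T : 'B(H1, H2)) (I : Type) (F : set_system I) {FF : Filter F}
  (u : I -> H1) x : u @ F --> x -> T \o u @ F --> T x.
Proof.
move=> /cvgrPdist_le ux; apply/cvgrPdist_le => d d0.
have [M M0 TM] := bop_bounded T.
have M1 : 0 < M + 1 by rewrite ltr_wpDl.
apply: filterS (ux _ (divr_gt0 d0 M1)) => i; rewrite ler_pdivlMr// => ui.
rewrite /= -linearB (le_trans (TM _))// (le_trans _ ui)// mulrC ler_wpM2l//.
by rewrite lerDl.
Qed.

(** * Families with equal Gram matrices and the unitary between their closed spans *)

Section IsometryExtension.
Context {H1 H2 : hilbertType R} {I : Type} (u : I -> H1) (v : I -> H2).
Hypothesis uv : forall i j, inner (u i) (u j) = inner (v i) (v j).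

(** The graph of [sum c_i u_i |-> sum c_i v_i], kept as a relation since the [u_i] may be linearly
    dependent. Equal Gram matrices make it isometric, hence single-valued. *)
Let span_pair (x : H1) (y : H2) :=
  exists (n : nat) (c : 'I_n -> R[i]) (s : 'I_n -> I),
  x = \sum_(i < n) c i *: u (s i) /\ y = \sum_(i < n) c i *: v (s i).

Let span_pair_inner x y x' y' :
  span_pair x y -> span_pair x' y' -> inner x x' = inner y y'.
Proof.
move=> [n [c [s [-> ->]]]] [m [b [t [-> ->]]]].
rewrite !inner_suml; apply: eq_bigr => i _; rewrite !inner_sumr.
by apply: eq_bigr => j _; rewrite !innerZl !innerZr uv.
Qed.

Let span_pair_dist x y x' y' :
  span_pair x y -> span_pair x' y' -> `|y - y'| = `|x - x'|.
Proof.
move=> xy xy'; apply/eqP; rewrite -(@eqrXn2 _ 2)// -!inner_norm !innerBl !innerBr.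
by rewrite !(span_pair_inner xy xy', span_pair_inner xy xy,
  span_pair_inner xy' xy', span_pair_inner xy' xy).
Qed.

(** The vector [y] is the limit of the images of span elements approaching [x]. Its inner products
    with the [v i] determine it once these span densely, which later yields linearity. *)
Lemma isometry_extension_at x : dense_span (range u) ->
  exists2 y, forall i, inner (v i) y = inner (u i) x & `|y| <= `|x|.
Proof.
move=> du.
pose A (d : R[i]) := [set y | exists2 x', span_pair x' y & `|x - x'| <= d].
have Ane d : 0 < d -> A d !=set0.
  have : closure (lspan (range u)) x by rewrite du.
  move=> /closureP xd /xd[_ [n [c [w [uw ->]]]] xw].
  have /choice[s us] : forall i, exists j, u j = w i.
    by move=> i; have [j] := uw i; exists j.
  exists (\sum_(i < n) c i *: v (s i)), (\sum_(i < n) c i *: u (s i)).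
    by exists n, c, s.
  by under eq_bigr do rewrite us.
have [|y yA] := complete_approx Ane.
  move=> d d' y y' _ _ [z zy xz] [z' zy' xz'].
  rewrite (span_pair_dist zy zy') -(subrKA x) (le_trans (ler_normD _ _))// lerD//.
  by rewrite distrC.
exists y => [i|].
  have vi : span_pair (u i) (v i).
    by exists 1%N, (fun=> 1), (fun=> i); rewrite !big_ord1 !scale1r.
  apply/eqP; rewrite -subr_eq0 -normr_le0.
  apply: (@le0_approx _ (`|v i| + `|u i|)) ; last exact: addr_ge0.
  move=> d /yA[z [x' xz xx'] yz].
  rewrite -(subrKA (inner (v i) z)) -innerBr -(span_pair_inner vi xz) -innerBr.
  rewrite (le_trans (ler_normD _ _))// mulrDl lerD//.
    by rewrite (le_trans (cauchy_schwarz _ _))// ler_wpM2l.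
  by rewrite (le_trans (cauchy_schwarz _ _))// ler_wpM2l// distrC.
apply/ler_addgt0Pl => d d0.
have [z [x' xz xx'] yz] := yA _ (divr_gt0 d0 (ltr0Sn _ 1)).
have zx' : `|z| = `|x'|.
  apply/eqP; rewrite -(@eqrXn2 _ 2)// -!inner_norm.
  by rewrite (span_pair_inner xz xz).
rewrite -(subrK z y) (le_trans (ler_normD _ _))// zx' -(subrK x x').
rewrite (splitr d) -(addrA (d / 2)) lerD// (le_trans (ler_normD _ _))// lerD//.
by rewrite distrC.
Qed.

End IsometryExtension.

(** The extension is built in both directions. The two operators exchange [u i] and [v i], so the
    second is both adjoint and inverse of the first. *)
Lemma unitary_extension H1 H2 (I : Type) (u : I -> H1) (v : I -> H2) :
    (forall i j, inner (u i) (u j) = inner (v i) (v j)) ->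
    dense_span (range u) -> dense_span (range v) ->
  exists2 U : 'B(H1, H2), unitary_op U & forall i, U (u i) = v i.
Proof.
move=> uv du dv.
have ext (G1 G2 : hilbertType R) (a : I -> G1) (b : I -> G2) :
    (forall i j, inner (a i) (a j) = inner (b i) (b j)) ->
    dense_span (range a) -> dense_span (range b) ->
    exists A : 'B(G1, G2), forall x i, inner (b i) (A x) = inner (a i) x.
  move=> ab da db.
  have /choice[f fab] : forall x, exists y,
      (forall i, inner (b i) y = inner (a i) x) /\ `|y| <= `|x|.
    by move=> x; have [y yb yx] := isometry_extension_at ab x da; exists y.
  suff fb : f \in bounded_linear by exists (Bop fb) => x i; apply: (fab x).1.
  apply/asboolP; split=> [c x y|].
    apply: (inner_dense_eq db) => _ [i _ <-].
    by rewrite innerDr innerZr !(fab _).1 innerDr innerZr.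
  by exists 1 => x; rewrite mul1r (fab x).2.
have [U Uuv] := ext _ _ _ _ uv du dv.
have [U' U'uv] := ext _ _ _ _ (fun i j => esym (uv i j)) dv du.
have Uu i : U (u i) = v i.
  by apply: (inner_dense_eq dv) => _ [j _ <-]; rewrite Uuv uv.
have U'v i : U' (v i) = u i.
  by apply: (inner_dense_eq du) => _ [j _ <-]; rewrite U'uv uv.
have U'E : U^† = U'.
  apply: esym.
  apply: (bop_dense_eq dv) => _ [i _ <-]; apply: inner_eq => z.
  by rewrite adjPr U'v [RHS]inner_conj Uuv -inner_conj.
exists U => //; rewrite /unitary_op U'E; split.
  by apply: (bop_dense_eq du) => _ [i _ <-] /=; rewrite Uu U'v.
by apply: (bop_dense_eq dv) => _ [i _ <-] /=; rewrite U'v Uu.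
Qed.

End Operators.

(** * Unordered sums of mutually orthogonal projections *)

Lemma partial_sumE (I : choiceType) (V : zmodType) (x : I -> V) (A : {fset I}) :
  partial_sum x A = \sum_(i <- A) x i.
Proof. by rewrite /partial_sum -(big_seq_fsetE _ _ xpredT). Qed.

Section Projections.
Context {R : realType} {H : hilbertType R}.

Lemma projection_contraction (P : 'B(H)) :
    (forall x, P (P x) = P x) -> (forall x y, inner (P x) y = inner x (P y)) ->
  forall x, `|P x| <= `|x|.
Proof.
move=> PP Psa x; apply: norm_inner_le => //.
by rewrite Psa PP cauchy_schwarz.
Qed.

Context (I : choiceType) (p : I -> 'B(H)).
Hypothesis p_mul : forall i j x, p i (p j x) = if i == j then p j x else 0.
Hypothesis p_sa : forall i x y, inner (p i x) y = inner x (p i y).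

Lemma projection_sum_fix (A : {fset I}) j x :
  j \in A -> partial_sum p A (p j x) = p j x.
Proof.
move=> jA; rewrite partial_sumE bop_sum (big_fsetD1 j)//= p_mul eqxx.
rewrite big1_fset ?addr0// => i; rewrite !inE => /andP[/negPf ij _] _.
by rewrite p_mul ij.
Qed.

Lemma projection_sum_sa (A : {fset I}) x y :
  inner (partial_sum p A x) y = inner x (partial_sum p A y).
Proof.
rewrite partial_sumE !bop_sum inner_suml inner_sumr.
by apply: eq_bigr => i _; rewrite p_sa.
Qed.

Lemma projection_sum_idem (A : {fset I}) x :
  partial_sum p A (partial_sum p A x) = partial_sum p A x.
Proof.
have sE : partial_sum p A x = \sum_(i <- A) p i x.
  by rewrite partial_sumE bop_sum.
rewrite [in LHS]sE linear_sum/= sE.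
by apply: eq_big_seq => i iA; rewrite projection_sum_fix.
Qed.

(** The complement of a finite sum of the [p i] is again a self-adjoint idempotent. *)
Lemma projection_compl_contraction (A : {fset I}) x :
  `|x - partial_sum p A x| <= `|x|.
Proof.
rewrite -[x - _](bopB (bid H)); apply: projection_contraction.
  move=> {}x; rewrite !bopB /= linearB/= projection_sum_idem.
  by rewrite subrr subr0.
by move=> {}x y; rewrite !bopB /= innerBl innerBr projection_sum_sa.
Qed.

(** On the range of [p i] the partial sums fix each vector as soon as [i] belongs to [A];
    contractivity of the complements, uniform in [A], carries convergence to limits. *)
Lemma projection_sum_cvg :
    dense_span [set y | exists i x, y = p i x] ->
  forall x, (fun A => partial_sum p A x) @ totally --> x.
Proof.
move=> dp; apply: (dense_span_ind dp) => [_ [i [x ->]]||c u v cu cv|u ud].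
- apply/cvgrPdist_le => d d0; exists [fset i]%fset => // A /=.
  rewrite fsub1set => iA.
  by rewrite projection_sum_fix// subrr normr0 ltW.
- by under eq_fun do rewrite linear0; exact: cvg_cst.
- under eq_fun do rewrite linearP.
  by apply: cvgD => //; apply: cvgZr.
- apply/cvgrPdist_le => d d0.
  have [v /cvgrPdist_le cv uv] := ud _ (divr_gt0 d0 (ltr0Sn _ 1)).
  apply: filterS (cv _ (divr_gt0 d0 (ltr0Sn _ 1))) => A vA.
  have -> : u - partial_sum p A u =
      (v - partial_sum p A v) + ((u - v) - partial_sum p A (u - v)).
    by rewrite linearB/= opprB addrACA (addrC v) subrK addKr.
  rewrite (le_trans (ler_normD _ _))// (splitr d) lerD//.
  by rewrite (le_trans (projection_compl_contraction _ _)).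
Qed.

End Projections.

(** * Finite-rank projections attached to an orthonormal basis *)

Section BasisProjections.
Context {R : realType} {H : hilbertType R} {J : choiceType} {e : J -> H}.
Hypothesis e_basis : orthonormal_basis e.

Let p i : 'B(H) := ketbra (e i) (e i).

Lemma basis_projection_mul i j x : p i (p j x) = if i == j then p j x else 0.
Proof.
rewrite /= innerZr e_basis.1; case: eqP => [->|_]; first by rewrite mulr1.
by rewrite mulr0 scale0r.
Qed.

Lemma basis_projection_sa i x y : inner (p i x) y = inner x (p i y).
Proof. by rewrite -[p i in LHS]adjK adjP adj_ketbra. Qed.

Lemma basis_compl_contraction (A : {fset J}) x :
  `|x - partial_sum p A x| <= `|x|.
Proof.
exact: (projection_compl_contraction basis_projection_mul basis_projection_sa).
Qed.

Lemma basis_sum_cvg x : (fun A => partial_sum p A x) @ totally --> x.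
Proof.
apply: (projection_sum_cvg basis_projection_mul basis_projection_sa).
apply: (dense_span_trans e_basis.2) => _ [i _ <-].
apply/subset_closure/mem_lspan; exists i, (e i).
by rewrite /= e_basis.1 eqxx scale1r.
Qed.

End BasisProjections.

(** * Ultraweak convergence and normality *)

Lemma cvg_initial_topology (S : choiceType) (T : topologicalType) (f : S -> T)
    (F : set_system S) (s : S) : Filter F ->
  F --> (s : initial_topology f) <-> f @ F --> f s.
Proof.
move=> FF; split=> [Fs|fF A].
  by apply: cvg_comp Fs _; exact: initial_continuous.
move=> [_ [[B Bo <-] Bfs BA]].
have /fF FB : nbhs (f s) B by rewrite nbhsE; exists B.
by rewrite nbhs_filterE; exact: filterS BA FB.
Qed.

(** The pointwise topology is the supremum of the initial topologies of the evaluations. *)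
Lemma cvg_prod_topology (U : Type) (T : topologicalType)
    (F : set_system {ptws U -> T}) (f : {ptws U -> T}) : Filter F ->
  F --> f <-> forall u, (fun g => g u) @ F --> f u.
Proof.
move=> FF; split=> [/cvg_sup Ff u|Fu].
  by have /cvg_initial_topology := Ff u.
by apply/cvg_sup => u; apply/cvg_initial_topology; exact: Fu.
Qed.

Section Ultraweak.
Context {R : realType} {H : hilbertType R}.

Lemma cvg_ultraweak (X : Type) (F : set_system X) (C : X -> 'B(H)) (T : 'B(H)) :
    Filter F ->
  (C : X -> ultraweak H) @ F --> (T : ultraweak H) <->
  forall q, (fun t => ultraweak_functional (C t) q) @ F --> ultraweak_functional T q.
Proof.
move=> FF; split=> [/cvg_initial_topology/cvg_prod_topology CT q|CT].
  exact: CT.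
by apply/cvg_initial_topology/cvg_prod_topology => q; exact: CT.
Qed.

(** Dominated convergence: a finite head tends to 0 termwise, and the tail is at most [|M|^2] times
    a tail of [sum |x k|^2]. The bound is uniform in [n], so it survives the limit of the series. *)
Lemma sq_summable_contraction_cvg (X : Type) (F : set_system X)
    (C : X -> 'B(H)) (M : R[i]) (x : nat -> H) : Filter F ->
    (forall t y, `|C t y| <= M * `|y|) -> (forall y, (fun t => C t y) @ F --> 0) ->
    sq_summable x ->
  forall d : R[i], 0 < d ->
    \forall t \near F, forall n, \sum_(k < n) `|C t (x k)| ^+ 2 <= d.
Proof.
move=> FF CM C0 sx d d0.
have fin N (b : R[i]) : 0 < b ->
    \forall t \near F, \sum_(k < N) `|C t (x k)| ^+ 2 <= b.
  elim: N b => [b b0|N IH b b0]; first by apply: nearW => t; rewrite big_ord0 ltW.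
  have b2 : 0 < b / 2 by rewrite divr_gt0.
  (* With [m <= 1] the square of a norm at most [m] is bounded by that norm, hence by [b / 2]. *)
  have [m m0 [mb m1]] := exists_min_gt0 b2 ltr01.
  have /cvgrPdist_le/(_ _ m0) := C0 (x N).
  apply: filterS2 (IH _ b2) => t tN; rewrite sub0r normrN => tx.
  rewrite big_ord_recr/= (splitr b) lerD// (le_trans _ mb)// expr2.
  by rewrite (le_trans _ tx)// ler_piMl// (le_trans tx).
have M1 : 0 < `|M| ^+ 2 + 1 by rewrite ltr_wpDl// exprn_ge0.
(* Chosen so that [|M|^2 b <= d / 2]. *)
pose b := d / 2 / (`|M| ^+ 2 + 1).
have b0 : 0 < b by rewrite !divr_gt0.
have [N tail] : exists N, forall n, (N <= n)%N -> \sum_(N <= k < n) `|x k| ^+ 2 <= b.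
  have /cvg_ex[l /cvgrPdist_le/(_ _ (divr_gt0 b0 (ltr0Sn _ 1)))[N _ Nl]] := sx.
  exists N => n Nn.
  have := lerD (Nl _ (leqnn N)) (Nl _ Nn).
  rewrite -splitr; apply: le_trans.
  rewrite [X in X + _]distrC.
  apply: le_trans (ler_normD _ _); rewrite subrKA.
  rewrite distrC sub_series_geq// ger0_norm//.
  by apply: sumr_ge0 => i _; rewrite exprn_ge0.
have d2 : 0 < d / 2 by rewrite divr_gt0.
apply: filterS (fin N _ d2) => t tN n.
have [nN|Nn] := leqP n N.
  rewrite (le_trans _ (le_trans tN _))//.
    rewrite -(subnKC nN) big_split_ord/= lerDl; apply: sumr_ge0 => i _.
    by rewrite exprn_ge0.
  by rewrite ler_pdivrMr// ler_pMr// ler1n.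
rewrite -(big_mkord xpredT (fun k => `|C t (x k)| ^+ 2)).
rewrite (big_cat_nat (n := N))//= ?(ltnW Nn)// big_mkord (splitr d) lerD//.
rewrite (@le_trans _ _ (\sum_(N <= k < n) `|M| ^+ 2 * `|x k| ^+ 2))//.
  apply: ler_sum => k _; rewrite -exprMn ler_pXn2r ?nnegrE ?mulr_ge0//.
  rewrite (le_trans (CM _ _))// (le_trans (real_ler_norm _))//.
    by rewrite ger0_real// (le_trans _ (CM t _)).
  by rewrite normrM normr_id.
rewrite -mulr_sumr (le_trans (ler_wpM2l _ (tail _ (ltnW Nn))))//.
  by rewrite exprn_ge0.
rewrite /b mulrCA ler_piMr ?(ltW d2)//.
by rewrite ler_pdivrMr// mul1r lerDl.
Qed.

(* No convergence is assumed: the junk limit of a divergent sequence is [0]. *)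
Lemma limn_norm_le (u : nat -> R[i]^o) (b : R[i]) :
  (forall n, `|u n| <= b) -> `|limn u| <= b.
Proof.
move=> ub; have b0 : 0 <= b by rewrite (le_trans _ (ub 0%N)).
have [/cvgrPdist_le cu|/dvgP ->] := pselect (cvgn u); last first.
  by rewrite (_ : point = 0)// normr0.
apply/ler_addgt0Pl => d /cu[N _ /(_ _ (leqnn N)) uN].
by rewrite -(subrK (u N) (limn u)) (le_trans (ler_normD _ _))// lerD.
Qed.

(** Since [<x_n, C^† C y_n> = <C x_n, C y_n>], the partial sums are dominated by those of
    [|C x_n|^2 + |C y_n|^2], which are uniformly small. *)
Lemma cvg_ultraweak0 (X : Type) (F : set_system X)
    (C : X -> 'B(H)) (M : R[i]) : Filter F ->
    (forall t y, `|C t y| <= M * `|y|) -> (forall y, (fun t => C t y) @ F --> 0) ->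
  ((fun t => (C t)^† ∘ C t) : X -> ultraweak H) @ F --> (0 : ultraweak H).
Proof.
move=> FF CM C0; apply/cvg_ultraweak => -[[x y] [/= sx sy]].
have -> : ultraweak_functional (0 : 'B(H)) (exist _ (x, y) (conj sx sy)) = 0.
  apply/eqP; rewrite -normr_le0; apply: limn_norm_le => n.
  by rewrite /series/= big1 ?normr0// => i _; exact: inner0r.
apply/cvgrPdist_le => d d0; have d2 : 0 < d / 2 by rewrite divr_gt0.
have := sq_summable_contraction_cvg FF CM C0 sx d2.
apply: filterS2 (sq_summable_contraction_cvg FF CM C0 sy d2) => t ty tx.
rewrite sub0r normrN; apply: limn_norm_le => n; rewrite /series/= big_mkord.
rewrite (le_trans (ler_norm_sum _ _ _))// (splitr d).
rewrite (le_trans _ (lerD (tx n) (ty n)))// -big_split/=.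
apply: ler_sum => i _; rewrite adjPr (le_trans (cauchy_schwarz _ _))//.
(* With [a], [b] the two norms, [(a - b)^2 >= 0] gives [a b <= 2 a b <= a^2 + b^2]. *)
have := real_exprn_even_ge0 (n := 2) (x := `|C t (x i)| - `|C t (y i)|).
rewrite rpredB ?normr_real// => /(_ isT isT).
rewrite sqrrB addrAC subr_ge0; apply: le_trans.
by rewrite mulr2n lerDl mulr_ge0.
Qed.

Lemma normal_map_cvg0 (phi : {linear 'B(H) -> 'B(H)}) (X : Type) (F : set_system X)
    {FF : Filter F} (C : X -> 'B(H)) (M : R[i]) (x : H) : normal_map phi ->
    (forall t y, `|C t y| <= M * `|y|) -> (forall y, (fun t => C t y) @ F --> 0) ->
  (fun t => inner x (phi ((C t)^† ∘ C t) x) : R[i]^o) @ F --> 0.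
Proof.
move=> phin CM C0.
(* The sequence [(x, 0, 0, ...)] makes [T |-> <x, T x>] one of the ultraweak functionals. *)
pose s n : H := if n is 0%N then x else 0.
have seriesE (u : nat -> R[i]^o) :
    (forall n, u n.+1 = 0) -> series u @ \oo --> u 0%N.
  (* The partial sum at index 0 is empty; from index 1 on it equals [u 0]. *)
  move=> u0; apply/cvgrPdist_le => d d0; exists 1%N => // -[//|n] _ /=.
  by rewrite /series/= big_nat_recl// big1 ?addr0 ?subrr ?normr0 ?ltW.
have ss : sq_summable s.
  apply/cvg_ex; exists (`|x| ^+ 2).
  by apply: (seriesE (fun n => `|s n| ^+ 2)) => n /=; rewrite normr0 expr0n.
pose q : sq_summable_pair := exist _ (s, s) (conj ss ss).
have qE T : ultraweak_functional T q = inner x (T x).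
  apply: (cvg_lim (@norm_hausdorff _ R[i]^o)).
  apply: (seriesE (fun n => inner (s n) (T (s n)))) => n /=.
  by rewrite inner0l.
have /cvg_ultraweak/(_ q) :
    (phi \o (fun t => (C t)^† ∘ C t) : X -> ultraweak H) @ F -->
      (phi 0 : ultraweak H).
  exact: cvg_comp (cvg_ultraweak0 FF CM C0) (phin 0).
rewrite linear0 qE [inner x _]inner0r.
by under eq_fun do rewrite qE.
Qed.

End Ultraweak.

(** * Elementary tensors, amplifications and slices *)

Section Tensor.
Context {R : realType} {H1 H2 : hilbertType R} (HT : htensor H1 H2).

Lemma norm_tens x y : `|tens HT x y| = `|x| * `|y|.
Proof.
apply/eqP; rewrite -(@eqrXn2 _ 2)// ?mulr_ge0// exprMn -!inner_norm.
by rewrite inner_tens.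
Qed.

Fact tensl_subproof x : (tens HT x : H2 -> HT) \in bounded_linear.
Proof.
apply/asboolP; split=> [c u v|]; first by rewrite linearPr.
by exists `|x| => y; rewrite norm_tens.
Qed.

Definition tensl x : 'B(H2, HT) := Bop (tensl_subproof x).

Fact tensr_subproof y : (fun x => tens HT x y) \in bounded_linear.
Proof.
apply/asboolP; split=> [c u v|]; first by rewrite linearPl.
by exists `|y| => x; rewrite norm_tens mulrC.
Qed.

Definition tensr y : 'B(H1, HT) := Bop (tensr_subproof y).

(** For fixed [x] the map [y |-> tens HT x y] is linear and bounded, so approximating [y] from the
    span of [A] approximates [tens HT x y]. *)
Lemma tens_dense_r (A : set H2) :
  dense_span A -> dense_span [set z | exists x y, A y /\ z = tens HT x y].
Proof.
move=> dA; apply: (dense_span_trans (tens_dense HT)) => _ [[x y] _ <-] /=.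
apply/closureP => d d0.
have x1 : 0 < `|x| + 1 by rewrite ltr_wpDl.
have : closure (lspan A) y by rewrite dA.
move=> /closureP/(_ _ (divr_gt0 d0 x1))[_ [n [c [v [Av ->]]]] yv].
exists (tensl x (\sum_(i < n) c i *: v i)).
  exists n, c, (fun i => tens HT x (v i)); split=> [i|]; first by exists x, (v i).
  by rewrite linear_sum; apply: eq_bigr => i _; rewrite linearZ.
rewrite -[tens HT x y]/(tensl x y) -linearB/= norm_tens.
move: yv; rewrite ler_pdivlMr// mulrC; apply: le_trans.
by rewrite ler_wpM2r// lerDl.
Qed.

Lemma tensI_eq (S : 'B(H1)) (A : 'B(HT)) :
  (forall x y, A (tens HT x y) = tens HT (S x) y) -> tensI HT S = A.
Proof.
move=> AS; apply: xget_unique => // B BS.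
by apply: (bop_dense_eq (tens_dense HT)) => _ [[x y] _ <-]; rewrite AS BS.
Qed.

Lemma adj_tensr_tens f x y : (tensr f)^† (tens HT x y) = inner f y *: x.
Proof.
apply: inner_eq => z.
by rewrite adjPr inner_tens innerZr mulrC.
Qed.

(** The adjoint has the defining property of [slice], and density of elementary tensors makes it the
    only such operator. *)
Lemma slice_eq f : slice HT f = (tensr f)^†.
Proof.
apply: xget_unique => [x y|B Bf]; first exact: adj_tensr_tens.
apply: (bop_dense_eq (tens_dense HT)) => _ [[x y] _ <-].
by rewrite adj_tensr_tens Bf.
Qed.

(** The summands are the projections of [u] onto the mutually orthogonal subspaces [H1 ⊗ f_i], which
    together span densely. *)
Lemma slice_sum_cvg (I : choiceType) (f : I -> H2) (u : HT) :
    orthonormal_basis f ->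
  partial_sum (fun i => tensr (f i) (slice HT (f i) u)) @ totally --> u.
Proof.
move=> [ff df].
pose p i : 'B(HT) := tensr (f i) ∘ slice HT (f i).
have -> : partial_sum (fun i => tensr (f i) (slice HT (f i) u)) =
    (fun A => partial_sum p A u).
  by apply/funext => A; rewrite !partial_sumE bop_sum.
apply: projection_sum_cvg => [i j x|i x y|].
- rewrite /p /= !slice_eq -[tens HT _ (f j)]/(tensr (f j) _) /= adj_tensr_tens ff.
  by case: eqP => [->|_]; rewrite ?scale1r// scale0r -[LHS]/(tensr _ 0) linear0.
- have pE z : p i z = tensr (f i) ((tensr (f i))^† z) by rewrite /p slice_eq.
  by rewrite !pE -adjPr adjP.
apply: (dense_span_trans (tens_dense_r df)) => _ [x [_ [[i _ <-] ->]]].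
apply/subset_closure/mem_lspan; exists i, (tens HT x (f i)).
by rewrite /p /= slice_eq adj_tensr_tens ff eqxx scale1r.
Qed.

End Tensor.

(** * Kernel sections, their rank-one expansion and the unitary *)

Lemma rkhs_inner (R : realType) (X : Type) (L : X -> X -> R[i]) (K : rkhs L) x y :
  inner (rkhs_sec K x) (rkhs_sec K y) = L x y.
Proof. by rewrite -rkhs_ev_reproducing rkhs_ev_sec. Qed.

Section KernelDilation.
Context {R : realType} {H : hilbertType R} (phi : {linear 'B(H) -> 'B(H)}).
Context (HK : rkhs (cp_kernel phi)) (pi : {linear 'B(H) -> 'B(HK)}) (V : 'B(H, HK)).
Hypothesis VE : forall b, V b = rkhs_sec HK (bid H, b).
Hypothesis piE : forall S T b, pi S (rkhs_sec HK (T, b)) = rkhs_sec HK (S ∘ T, b).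

(** Written this way, sections inherit linearity in [T] from [pi]. *)
Lemma kernel_sectionE T b : rkhs_sec HK (T, b) = pi T (V b).
Proof. by rewrite VE piE; congr (rkhs_sec HK (_, b)); apply: bop_eq. Qed.

Lemma norm_kernel_section T b :
  `|rkhs_sec HK (T, b)| ^+ 2 = inner b (phi (T^† ∘ T) b).
Proof. by rewrite -inner_norm rkhs_inner. Qed.

Context (J : choiceType) (e : J -> H).

Lemma kernel_section_partial_sum (T : 'B(H)) b (A : {fset J}) :
  partial_sum (fun i => rkhs_sec HK (ketbra (T (e i)) (e i), b)) A =
  rkhs_sec HK (T ∘ partial_sum (fun i => ketbra (e i) (e i)) A, b).
Proof.
have -> : T ∘ partial_sum (fun i => ketbra (e i) (e i)) A =
    \sum_(i <- A) ketbra (T (e i)) (e i).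
  apply: bop_eq => h; rewrite /= partial_sumE !bop_sum linear_sum.
  by apply: eq_bigr => i _; rewrite /= linearZ.
rewrite kernel_sectionE linear_sum/= bop_sum partial_sumE.
by apply: eq_bigr => i _; rewrite kernel_sectionE.
Qed.

Hypothesis phi_normal : normal_map phi.
Hypothesis e_basis : orthonormal_basis e.

(* The squared error is [<b, phi (Q T^* T Q) b>], with [Q] the complement of a
   finite basis projection: this is where normality enters. *)
Lemma kernel_section_cvg (T : 'B(H)) b :
  partial_sum (fun i => rkhs_sec HK (ketbra (T (e i)) (e i), b)) @ totally
    --> rkhs_sec HK (T, b).
Proof.
pose P A : 'B(H) := partial_sum (fun i => ketbra (e i) (e i)) A.
(* This is [T Q], so [C^† C] is [Q T^† T Q]. *)
pose C A : 'B(H) := T - T ∘ P A.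
have [M M0 TM] := bop_bounded T.
have CE A x : C A x = T (x - P A x) by rewrite linearB.
have CM A x : `|C A x| <= M * `|x|.
  rewrite CE (le_trans (TM _))// ler_wpM2l//.
  exact: (basis_compl_contraction e_basis).
have C0 x : (fun A => C A x) @ totally --> 0.
  under eq_fun do rewrite CE.
  rewrite -(linear0 T); apply: bop_cvg.
  rewrite -(subrr x); apply: cvgB; first exact: cvg_cst.
  exact: (basis_sum_cvg e_basis).
have /cvgrPdist_le dist0 :=
  normal_map_cvg0 (FF := totally_filter) b phi_normal CM C0.
apply/cvgrPdist_le => d d0.
(* Normality controls the squared norm of the section at [C A], hence the tolerance [d ^+ 2]. *)
apply: filterS (dist0 _ (exprn_gt0 2 d0)) => A; rewrite sub0r normrN.
rewrite -norm_kernel_section normrX normr_id ler_pXn2r ?nnegrE ?(ltW d0)//.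
by rewrite kernel_section_partial_sum !kernel_sectionE -bopB -linearB.
Qed.

(** Every section is a limit of partial sums lying in the span of the rank-one sections. *)
Lemma kernel_section_dense :
  dense_span (range (fun q : H * (J * H) =>
    rkhs_sec HK (ketbra q.1 (e q.2.1), q.2.2))).
Proof.
apply: (dense_span_trans (rkhs_dense HK)) => _ [[T b] _ <-].
apply/closureP => d d0.
have /cvgrPdist_le/(_ _ d0)/(@filter_ex _ _ totally_filter)[A dA] :=
  @kernel_section_cvg T b.
exists (partial_sum (fun i => rkhs_sec HK (ketbra (T (e i)) (e i), b)) A) => //.
rewrite partial_sumE; elim/big_rec: _ => [|i x _ Px]; first exact: lspan0.
rewrite -[rkhs_sec _ _]scale1r; apply: lspanP => //.
by apply: mem_lspan; exists (T (e i), (i, b)).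
Qed.

Context (HKhat : rkhs (unit_kernel phi e)) (HT : htensor H HKhat).

Lemma unit_kernel_unitary :
  exists2 U : 'B(HK, HT), unitary_op U & forall x i b,
    U (rkhs_sec HK (ketbra x (e i), b)) = tens HT x (rkhs_sec HKhat (i, b)).
Proof.
have [|||U UU Uuv] := @unitary_extension _ HK HT (H * (J * H))
  (fun q => rkhs_sec HK (ketbra q.1 (e q.2.1), q.2.2))
  (fun q => tens HT q.1 (rkhs_sec HKhat q.2)).
- move=> [x [i a]] [y [j b]]; rewrite inner_tens.
  rewrite !rkhs_inner /cp_kernel /unit_kernel/=.
  (* From [|x><e_i|^† |y><e_j| = <x, y> |e_i><e_j|], linearity of [phi] extracts [<x, y>]. *)
  by rewrite adj_ketbra ketbra_comp linearZ/=; exact: innerZr.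
- exact: kernel_section_dense.
- apply: (dense_span_trans (tens_dense_r HT (rkhs_dense HKhat))).
  move=> _ [x [_ [[q _ <-] ->]]].
  by apply/subset_closure/mem_lspan; exists (x, q).
by exists U => // x i b; apply: (Uuv (x, (i, b))).
Qed.

End KernelDilation.

(** * The dilation carried to the tensor product, and the Kraus sum *)

Theorem theorem3p1 (R : realType) (H : hilbertType R)
    (phi : {linear 'B(H) -> 'B(H)})
    (phi_cp : completely_positive phi) (phi_normal : normal_map phi)
    (HK : rkhs (cp_kernel phi))
    (pi : {linear 'B(H) -> 'B(HK)}) (V : 'B(H, HK))
    (pi_V_dilation : stinespring_dilation phi pi V)
    (pi_V_minimal : minimal_dilation pi V)
    (VE : forall b, V b = rkhs_sec HK (bid H, b))
    (piE : forall S T b, pi S (rkhs_sec HK (T, b)) = rkhs_sec HK (S ∘ T, b))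
    (J : choiceType) (e : J -> H) (e_basis : orthonormal_basis e)
    (HKhat : rkhs (unit_kernel phi e)) (HT : htensor H HKhat) :
  exists W : 'B(H, HT),
    [/\ forall a,
          partial_sum (fun i => tens HT (e i) (rkhs_sec HKhat (i, a))) @ totally
            --> W a,
        exists U : 'B(HK, HT),
          [/\ unitary_op U,
              forall S, U ∘ pi S ∘ U^† = tensI HT S
            & U ∘ V = W],
        forall S, phi S = W^† ∘ tensI HT S ∘ W
      & forall (I : choiceType) (f : I -> HKhat), orthonormal_basis f ->
          let Va i := slice HT (f i) ∘ W in
          forall S h,
            partial_sum (fun i => ((Va i)^† ∘ S ∘ Va i) h) @ totally
              --> phi S h].
Proof.
have [U Uunitary UE] := unit_kernel_unitary VE piE phi_normal e_basis HT.
have UK u : U^† (U u) = u by rewrite -[LHS]/((U^† ∘ U) u) Uunitary.1.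
have piU S x y : (U ∘ pi S ∘ U^†) (tens HT x y) = tens HT (S x) y.
  (* For fixed [x] both sides are bounded in [y], so sections suffice: there [U^†] returns the
     section at [|x><e_i|], which [pi S] sends to the one at [|S x><e_i|]. *)
  suff E : U ∘ pi S ∘ U^† ∘ tensl HT x = tensl HT (S x).
    exact: (congr1 (fun A : 'B(HKhat, HT) => A y) E).
  apply: (bop_dense_eq (rkhs_dense HKhat)) => _ [[i b] _ <-] /=.
  by rewrite -UE UK piE comp_ketbra UE.
(* The conjugated representation also supplies the existence of the operator selected by [tensI]. *)
have Upi S : tensI HT S = U ∘ pi S ∘ U^† by exact: tensI_eq.
have tensIE S x y : tensI HT S (tens HT x y) = tens HT (S x) y.
  by rewrite Upi piU.
have WE S : phi S = (U ∘ V)^† ∘ tensI HT S ∘ (U ∘ V).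
  rewrite (dilationE pi_V_dilation) adj_comp Upi.
  by apply: bop_eq => h /=; rewrite !UK.
exists (U ∘ V); split=> [a|||I f f_basis Va S h].
(* The series for [W a] is the image under [U] of the rank-one expansion of [V a]. *)
- have <- : U \o partial_sum (fun i => rkhs_sec HK (ketbra (e i) (e i), a)) =
      partial_sum (fun i => tens HT (e i) (rkhs_sec HKhat (i, a))).
    apply/funext => A /=; rewrite !partial_sumE linear_sum.
    by apply: eq_bigr => i _; rewrite /= UE.
  rewrite /= VE; apply: bop_cvg.
  exact: (kernel_section_cvg VE piE phi_normal e_basis).
- by exists U; split.
- exact: WE.
(* As [slice] is adjoint to [tensr], each Kraus term is the bounded operator [W^† (S ⊗ I)] applied
   to one term of the expansion of [W h] along the [f i]. *)
have <- : ((U ∘ V)^† ∘ tensI HT S) \o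
    partial_sum (fun i => tensr HT (f i) (slice HT (f i) ((U ∘ V) h))) =
    partial_sum (fun i => ((Va i)^† ∘ S ∘ Va i) h).
  apply/funext => A; rewrite /= !partial_sumE !linear_sum.
  apply: eq_bigr => i _; rewrite /Va /= [(slice _ _ ∘ _)^†]adj_comp /=.
  by rewrite slice_eq adjK /= tensIE.
by rewrite WE; apply: bop_cvg; exact: slice_sum_cvg.
Qed.
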